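(* Let $F$ be a graded field, $D$ a graded central division algebra over $F$, $(\omega,d)$ the factor set of $\Gamma_D/\Gamma_F$ in $D_0$ described in the context, $K$ a Kummer graded subfield of $D$ and $\alpha_K\in Z^2(\Gamma_K/\Gamma_F,kum(K_0/F_0))_{sym}$ the cocycle described in the context. Then there exist a cocycle $d'\in Z^2(\Gamma_K/\Gamma_F,KUM(K_0/F_0))_{sym}$ (for the trivial action of $\Gamma_K/\Gamma_F$ on $KUM(K_0/F_0)$) and a map $\omega':\Gamma_K/\Gamma_F\to Aut(D_0)$ which satisfies $\omega'_{\bar\gamma}(a)=a$ for all $a\in K_0$ and $\bar\gamma\in\Gamma_K/\Gamma_F$, such that: 1. $(\omega',i_*d')$ is a factor set of $\Gamma_K/\Gamma_F$ in $D_0$ cohomologous to $res^{\Gamma_D/\Gamma_F}_{\Gamma_K/\Gamma_F}(\omega,d)$, and 2. $e_*([d'])=[\alpha_K]$.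
   Context: Graded objects. Gradings are by torsion-free (totally ordered) abelian groups. For a graded ring $R=\bigoplus_\gamma R_\gamma$, $\Gamma_R$ is its support $\{\gamma:R_\gamma\ne0\}$, $gr(x)=\gamma$ for $0\ne x\in R_\gamma$, and $R^*$ is the group of units. A graded field (resp. graded division algebra) is a commutative graded ring (resp. graded ring) in which every nonzero homogeneous element is invertible; its units are exactly the nonzero homogeneous elements. A graded central division algebra over a graded field $F$ is a graded division algebra $D$ with center $F$ (as graded ring) and $[D:F]<\infty$. A graded subfield of $D$ is a commutative graded subring containing $F$ that is a graded field. $\Gamma_D/\Gamma_F$ acts on $Z(D_0)$ via $\theta_D:\Gamma_D/\Gamma_F\to Gal(Z(D_0)/F_0)$, $\theta_D(gr(x)+\Gamma_F)(a)=xax^{-1}$ for $x\in D^*$. Factor sets. Let $A$ be a central simple algebra over a field $L$ and $H$ a finite group acting on $L$ by automorphisms. For $c\in A^*$, $Inn(c)(a)=cac^{-1}$. A factor set of $H$ in $A$ is a pair of maps $\omega:H\to Aut(A)$ (ring automorphisms), $f:H\times H\to A^*$ with $\omega_\sigma|_L=\sigma$, $\omega_\sigma\omega_\tau=Inn(f(\sigma,\tau))\omega_{\sigma\tau}$, and $f(\sigma,\tau)f(\sigma\tau,\mu)=\omega_\sigma(f(\tau,\mu))f(\sigma,\tau\mu)$. Two factor sets $(\omega,f)$ and $(\omega',f')$ are cohomologous if there are $a_\sigma\in A^*$ $(\sigma\in H)$ with $\omega'_\sigma=Inn(a_\sigma)\omega_\sigma$ and $f'(\sigma,\tau)=a_\sigma\omega_\sigma(a_\tau)f(\sigma,\tau)a_{\sigma\tau}^{-1}$.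 Here $A=D_0$, $L=Z(D_0)$, with the action of (subgroups of) $\Gamma_D/\Gamma_F$ via $\theta_D$. The factor set $(\omega,d)$. Let $H=\Gamma_D/\Gamma_F$ (a finite abelian group). Fix a basis $(\bar\delta_i=\delta_i+\Gamma_F)_{1\le i\le r}$ of $H$ (so $H$ is the direct sum of the cyclic groups generated by the $\bar\delta_i$), let $q_i$ be the order of $\bar\delta_i$, and $I=\{(m_1,\dots,m_r)\in\mathbb N^r:0\le m_i<q_i\}$. Fix $x_i\in F^*$ with $gr(x_i)=q_i\delta_i$ and $z_i\in D^*$ with $gr(z_i)=\delta_i$. For $\bar m\in I$ put $\bar m\bar\delta=\sum m_i\bar\delta_i$ and $z_{\bar m\bar\delta}=z^{\bar m}=z_1^{m_1}\cdots z_r^{m_r}$; every $\bar\gamma\in H$ is uniquely of the form $\bar m\bar\delta$. Let $\omega_{\bar\gamma}\in Aut(D_0)$ be $a\mapsto z_{\bar\gamma}az_{\bar\gamma}^{-1}$. For $\bar m,\bar n\in I$ write $m_i+n_i=\beta_i+t_iq_i$ with $0\le\beta_i<q_i$, $t_i\in\mathbb N$; put $h(\bar m\bar\delta,\bar n\bar\delta)=\prod_i x_i^{t_i}\in F^*$ and $d(\bar\gamma,\bar\gamma')=z_{\bar\gamma}z_{\bar\gamma'}z_{\bar\gamma+\bar\gamma'}^{-1}h(\bar\gamma,\bar\gamma')^{-1}\in D_0^*$. The pair $(\omega,d)$ is a factor set of $H$ in $D_0$; $res^H_R(\omega,d)$ is its restriction to a subgroup $R$. Kummer data. A finite-dimensional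 graded field extension $K/F$ is abelian if $Frac(K)/Frac(F)$ is abelian Galois ($Gal(K/F)$ is then its Galois group); it is Kummer if moreover $F_0$ contains a primitive $m$-th root of unity, $m$ the exponent of $Gal(K/F)$. Then $KUM(K/F)=\{x\in K^*:x^m\in F\}$, $kum(K/F)=KUM(K/F)/F^*$, and similarly for the ordinary Kummer extension $K_0/F_0$. There is an exact sequence of trivial $\Gamma_K/\Gamma_F$-modules $$1\to kum(K_0/F_0)\stackrel{\phi}{\to}kum(K/F)\stackrel{\psi}{\to}\Gamma_K/\Gamma_F\to0,$$ $\phi(aF_0^* )=aF^*$, $\psi(aF^* )=gr(a)+\Gamma_F$; $\alpha_K$ denotes a 2-cocycle representing this abelian group extension and $[\alpha_K]$ its class. The subscript $sym$ denotes symmetric 2-cocycles (resp. classes of these). $e:KUM(K_0/F_0)\to kum(K_0/F_0)$ is the canonical surjection, $e_*:H^2(\Gamma_K/\Gamma_F,KUM(K_0/F_0))_{sym}\to H^2(\Gamma_K/\Gamma_F,kum(K_0/F_0))_{sym}$ the induced map (trivial actions), $i:KUM(K_0/F_0)\to D_0^*$ the inclusion and $i_*d'=i\circ d'$. *)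

(* Defs.v *)
From HB Require Import structures.
From mathcomp Require Import all_boot all_order all_algebra.
From mathcomp Require Import all_fingroup all_solvable all_field.
From mathcomp Require Import ring_quotient boolp classical_sets functions.
Set Implicit Arguments.
Unset Strict Implicit.
Unset Printing Implicit Defensive.
Import GRing.Theory.
Local Open Scope classical_set_scope.
Local Open Scope ring_scope.

(* Everything attached to a graded division algebra D (its graded subfields,
   D_0, K_0, the groups R^*, KUM ...) is a subset of the ring D, and a map
   between such subsets is a function on D of which only the restriction to
   the relevant subset matters. *)

Definition torsion_free (Gam : zmodType) : Prop :=
  forall (g : Gam) (n : nat), (0 < n)%N -> g *+ n = 0 -> g = 0.

(* R is the direct sum of the additive subgroups [hcomp g]. *)
Record is_grading (Gam : zmodType) (R : unitRingType) (hcomp : Gam -> set R)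
    : Prop := IsGrading {
  grading0 : forall g, hcomp g 0;
  gradingB : forall g x y, hcomp g x -> hcomp g y -> hcomp g (x - y);
  grading1 : hcomp 0 1;
  gradingM : forall g h x y, hcomp g x -> hcomp h y -> hcomp (g + h) (x * y);
  grading_sum : forall x, exists (s : seq Gam) (c : Gam -> R),
    [/\ uniq s, forall g, hcomp g (c g) & x = \sum_(g <- s) c g];
  grading_direct : forall (s : seq Gam) (c : Gam -> R),
    uniq s -> (forall g, hcomp g (c g)) ->
    \sum_(g <- s) c g = 0 -> {in s, forall g, c g = 0}
}.

Record gradedRing (Gam : zmodType) := GradedRing {
  gring :> unitRingType;
  hcomp : Gam -> set gring;
  hcompP : is_grading hcomp
}.

(* [hasgr x g]: x is a nonzero homogeneous element and gr(x) = g *)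
Definition hasgr (Gam : zmodType) (R : gradedRing Gam) (x : R) (g : Gam)
  : Prop := x <> 0 /\ hcomp g x.

Definition supp (Gam : zmodType) (R : gradedRing Gam) (A : set R) : set Gam :=
  [set g | exists2 x, A x & hasgr x g].

(* A_0 *)
Definition deg0 (Gam : zmodType) (R : gradedRing Gam) (A : set R) : set R :=
  A `&` hcomp 0.

Definition center (R : unitRingType) (A : set R) : set R :=
  [set x | A x /\ forall y, A y -> x * y = y * x].

(* A^* *)
Definition units (R : unitRingType) (A : set R) : set R :=
  [set x | [/\ A x, x \is a GRing.unit & A x^-1]].

Record graded_subring (Gam : zmodType) (R : gradedRing Gam) (A : set R)
    : Prop := GradedSubring {
  gsub1 : A 1;
  gsubB : forall x y, A x -> A y -> A (x - y);
  gsubM : forall x y, A x -> A y -> A (x * y);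
  gsub_hom : forall (s : seq Gam) (c : Gam -> R),
    uniq s -> (forall g, hcomp g (c g)) ->
    A (\sum_(g <- s) c g) -> {in s, forall g, A (c g)}
}.

Definition graded_division (Gam : zmodType) (R : gradedRing Gam) (A : set R)
  : Prop := forall x g, A x -> hasgr x g -> units A x.

Definition graded_field (Gam : zmodType) (R : gradedRing Gam) (A : set R)
  : Prop :=
  [/\ graded_subring A, forall x y, A x -> A y -> x * y = y * x
    & graded_division A].

(* [A : B] is finite: A is free of finite rank as a left B-module *)
Definition finite_over (R : unitRingType) (A B : set R) : Prop :=
  exists (n : nat) (e : 'I_n -> R), (forall i, A (e i)) /\
    forall x, A x -> exists! c : {ffun 'I_n -> R},
      (forall i, B (c i)) /\ x = \sum_i c i * e i.

(* [gbase] is the graded field F, identified with its image in D. *)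
Record gcdAlg (Gam : zmodType) := GcdAlg {
  galg :> gradedRing Gam;
  gbase : set galg;
  gbase_field : graded_field gbase;
  galg_division : graded_division [set: galg];
  gbase_center : center [set: galg] = gbase;
  galg_finite : finite_over [set: galg] gbase
}.

Arguments gbase {Gam} g.

Definition graded_subfield (Gam : zmodType) (D : gcdAlg Gam) (K : set D)
  : Prop := graded_field K /\ (gbase D `<=` K).

Definition GamF (Gam : zmodType) (D : gcdAlg Gam) : {pred Gam} :=
  fun g => `[< supp (gbase D) g >].

Arguments GamF {Gam} D.

Section GradeGroup.
Variables (Gam : zmodType) (D : gcdAlg Gam).

Lemma hasgrM (x y : D) g h :
  x \is a GRing.unit -> hasgr x g -> hasgr y h -> hasgr (x * y) (g + h).
Proof.
move=> ux [_ hx] [y0 hy]; split; last exact: (gradingM (hcompP D)).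
by move=> xy0; apply: y0; rewrite -[y](mulKr ux) xy0 mulr0.
Qed.

Lemma hasgrV (x : D) g : hasgr x g -> hasgr x^-1 (- g).
Proof.
move=> hx; have [_ ux _] := galg_division (I : [set: D] x) hx.
split; first by apply/eqP; rewrite invr_eq0; apply/eqP; case: hx.
have [s [c [us hc Dx]]] := grading_sum (hcompP D) x^-1.
pose s' := undup (- g :: s).
pose c' h := if h \in s then c h else 0.
have G0 := grading0 (hcompP D); have GB := gradingB (hcompP D).
have hc' h : hcomp h (c' h) by rewrite /c'; case: ifP => _ //; exact: hc.
have us' : uniq s' by exact: undup_uniq.
have Dx' : x^-1 = \sum_(h <- s') c' h.
  rewrite /s' /=; case: ifP => gs; last first.
    rewrite big_cons /c' gs add0r undup_id // Dx.
    by apply: eq_big_seq => h ->.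
  by rewrite undup_id // Dx; apply: eq_big_seq => h hs; rewrite /c' hs.
pose e h := x * c' (h - g) - (if h == 0 then 1 else 0).
have he h : hcomp h (e h).
  apply: GB.
    by rewrite -[h in hcomp h](addrNK g) addrC; apply: (gradingM (hcompP D)) => //; case: hx.
  by case: eqP => [->|_] //; apply: (grading1 (hcompP D)).
have ut : uniq [seq h + g | h <- s'] by rewrite map_inj_uniq //; apply: addIr.
have ms : - g \in s' by rewrite mem_undup in_cons eqxx.
have se : \sum_(h <- [seq h + g | h <- s']) e h = 0.
  rewrite big_map /e sumrB (eq_bigr (fun h => x * c' h)) => [|h _]; last first.
    by rewrite addrK.
  rewrite -mulr_sumr -Dx' divrr // (bigD1_seq (- g)) //= addNr eqxx.
  rewrite big1 ?addr0 ?subrr // => h; rewrite -subr_eq0 opprK.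
  by move=> /negPf ->.
have m0 : 0 \in [seq h + g | h <- s'].
  by apply/mapP; exists (- g); rewrite ?addNr.
have := grading_direct (hcompP D) ut he se m0.
rewrite /e eqxx sub0r => /eqP; rewrite subr_eq0 => /eqP E.
by rewrite -[x^-1]mulr1 -E mulKr.
Qed.

Lemma GamF_zmod_closed : zmod_closed (GamF D).
Proof.
have [[F1 _ FM _] _ Fd] := gbase_field D.
split.
  apply/asboolP; exists 1 => //; split; first by apply/eqP; exact: oner_neq0.
  exact: (grading1 (hcompP D)).
move=> g h /asboolP[x Fx hx] /asboolP[y Fy hy]; apply/asboolP.
have [_ ux _] := Fd _ _ Fx hx; have [_ _ Fy'] := Fd _ _ Fy hy.
by exists (x * y^-1); [exact: FM | apply: hasgrM => //; exact: hasgrV].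
Qed.

End GradeGroup.

HB.instance Definition _ (Gam : zmodType) (D : gcdAlg Gam) :=
  GRing.isZmodClosed.Build Gam (GamF D) (GamF_zmod_closed D).

(* Gam / Gam_F; the groups Gam_D / Gam_F and Gam_K / Gam_F are subsets of it. *)
Definition gquot (Gam : zmodType) (D : gcdAlg Gam) : zmodType :=
  Quotient.quot (GamF D).

Definition gcl (Gam : zmodType) (D : gcdAlg Gam) (g : Gam) : gquot D :=
  (\pi_(Quotient.quot (GamF D)) g)%qT.

Definition suppq (Gam : zmodType) (D : gcdAlg Gam) (A : set D)
  : set (gquot D) := [set gcl D g | g in supp A].

(* theta_D(g)(a) = x a x^-1 for any x in D^* with gr(x) + Gam_F = g; on
   Z(D_0) this does not depend on the choice of x, see [thetaE]. *)
Definition theta (Gam : zmodType) (D : gcdAlg Gam) (g : gquot D) (a : D) : D :=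
  let x := xget 1 [set x : D | exists2 h, hasgr x h & gcl D h = g] in
  x * a * x^-1.

Lemma gclE (Gam : zmodType) (D : gcdAlg Gam) (g h : Gam) :
  gcl D g = gcl D h <-> supp (gbase D) (g - h).
Proof.
split=> [/eqP|H].
  by rewrite /gcl -Quotient.idealrBE => /asboolP.
by apply/eqP; rewrite /gcl -Quotient.idealrBE; apply/asboolP.
Qed.

Lemma thetaE (Gam : zmodType) (D : gcdAlg Gam) (x : D) (g : Gam) (a : D) :
  hasgr x g -> center (deg0 [set: D]) a ->
  theta (gcl D g) a = x * a * x^-1.
Proof.
move=> hx [_ ca]; rewrite /theta.
set y := xget _ _.
have [h hy hg] : exists2 h, hasgr y h & gcl D h = gcl D g.
  rewrite /y; case: xgetP => [_ _ //|/(_ x)]; case; by exists g.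
have unit (z : D) k : hasgr z k -> z \is a GRing.unit.
  by move=> hz; have [] := galg_division (I : [set: D] z) hz.
have [f Ff hf] := (gclE _ _ _).1 hg.
have ux := unit _ _ hx; have uy := unit _ _ hy; have uf := unit _ _ hf.
have fC z : f * z = z * f.
  by have := Ff; rewrite -gbase_center => -[_]; apply.
pose u := x^-1 * (y * f^-1).
have hu : hcomp 0 u.
  have [] := hasgrM (D := D) _ (hasgrV hx) (hasgrM uy hy (hasgrV hf)).
    by rewrite unitrV.
  by rewrite opprB [h + _]addrC addrNK addNr.
have yE : y = x * u * f by rewrite /u mulVKr // divrK.
have ua : u * a = a * u by rewrite ca.
clearbody u y.
have ya : y * a = x * a * x^-1 * y.
  by rewrite yE !mulrA divrK // -!mulrA fC [in LHS](mulrA u) ua !mulrA.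
by rewrite ya mulrK.
Qed.

(* The restriction of s to A is a ring automorphism of A. *)
Record ring_aut (R : unitRingType) (A : set R) (s : R -> R) : Prop := RingAut {
  raut_bij : set_bij A A s;
  raut1 : s 1 = 1;
  rautD : forall x y, A x -> A y -> s (x + y) = s x + s y;
  rautM : forall x y, A x -> A y -> s (x * y) = s x * s y
}.

(* The group is the subgroup S of G, written additively; it acts on Z(A) by
   [act]. Restricting a factor set to a smaller group only changes S. *)
Record factor_set (G : zmodType) (S : set G) (R : unitRingType) (A : set R)
    (act : G -> R -> R) (w : G -> R -> R) (f : G -> G -> R) : Prop :=
    FactorSet {
  fset_aut : forall s, S s -> ring_aut A (w s);
  fset_unit : forall s t, S s -> S t -> units A (f s t);
  fset_act : forall s a, S s -> center A a -> w s a = act s a;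
  fset_inn : forall s t a, S s -> S t -> A a ->
    w s (w t a) = f s t * w (s + t) a * (f s t)^-1;
  fset_cocycle : forall s t u, S s -> S t -> S u ->
    f s t * f (s + t) u = w s (f t u) * f s (t + u)
}.

Definition fset_cohomologous (G : zmodType) (S : set G) (R : unitRingType)
    (A : set R) (w : G -> R -> R) (f : G -> G -> R)
    (w' : G -> R -> R) (f' : G -> G -> R) : Prop :=
  exists a : G -> R,
    [/\ forall s, S s -> units A (a s),
        forall s x, S s -> A x -> w' s x = a s * w s x * (a s)^-1
      & forall s t, S s -> S t ->
          f' s t = a s * w s (a t) * f s t * (a (s + t))^-1].

Definition is_order (G : zmodType) (g : G) (q : nat) : Prop :=
  [/\ (0 < q)%N, g *+ q = 0 & forall n, (0 < n < q)%N -> g *+ n <> 0].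

(* S is the direct sum of the cyclic subgroups generated by the g_i. *)
Definition is_basis (G : zmodType) (S : set G) (r : nat) (g : 'I_r -> G)
  : Prop :=
  [/\ forall i, S (g i),
      forall s, S s -> exists m : 'I_r -> int, s = \sum_i g i *~ m i
    & forall m : 'I_r -> int, \sum_i g i *~ m i = 0 ->
        forall i, g i *~ m i = 0].

Record frame (Gam : zmodType) (D : gcdAlg Gam) := Frame {
  frank : nat;
  fdelta : 'I_frank -> Gam;
  ford : 'I_frank -> nat;
  fx : 'I_frank -> D;
  fz : 'I_frank -> D;
  fdeltaP : forall i, supp [set: D] (fdelta i);
  fbasis : is_basis (suppq [set: D]) (fun i => gcl D (fdelta i));
  fordP : forall i, is_order (gcl D (fdelta i)) (ford i);
  fxP : forall i, units (gbase D) (fx i);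
  fx_gr : forall i, hasgr (fx i) (fdelta i *+ ford i);
  fzP : forall i, units [set: D] (fz i);
  fz_gr : forall i, hasgr (fz i) (fdelta i)
}.

Arguments fdelta {Gam D} f i.
Arguments ford {Gam D} f i.
Arguments fx {Gam D} f i.
Arguments fz {Gam D} f i.

Section FactorSetOfFrame.
Variables (Gam : zmodType) (D : gcdAlg Gam) (b : frame D).

(* The unique multi-index m in I with g = sum_i m_i delta_i. *)
Definition mindex (g : gquot D) : {ffun 'I_(frank b) -> nat} :=
  xget [ffun=> 0%N] [set m : {ffun 'I_(frank b) -> nat} |
    (forall i, (m i < ford b i)%N) /\
    g = \sum_i gcl D (fdelta b i) *+ m i].

(* an ordered product: z_1^{m_1} ... z_r^{m_r} *)
Definition zbar (g : gquot D) : D := \prod_i fz b i ^+ mindex g i.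

Definition omega (g : gquot D) (a : D) : D := zbar g * a * (zbar g)^-1.

(* t_i is the quotient of m_i + n_i by q_i *)
Definition hfun (g g' : gquot D) : D :=
  \prod_i fx b i ^+ ((mindex g i + mindex g' i) %/ ford b i)%N.

Definition dfun (g g' : gquot D) : D :=
  zbar g * zbar g' * (zbar (g + g'))^-1 * (hfun g g')^-1.

End FactorSetOfFrame.

(* For commutative domains B <= A inside R, E is the field of fractions of A
   through j, and its base field k, embedded in E as [1%AS], is the field of
   fractions of B. If A and B are fields (as K_0 and F_0) this says that E/k
   is A/B. *)
Record is_frac_ext (R : unitRingType) (A B : set R) (k : fieldType)
    (E : splittingFieldType k) (j : R -> E) : Prop := IsFracExt {
  frac1 : j 1 = 1;
  fracD : forall x y, A x -> A y -> j (x + y) = j x + j y;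
  fracM : forall x y, A x -> A y -> j (x * y) = j x * j y;
  frac_inj : forall x y, A x -> A y -> j x = j y -> x = y;
  frac_top : forall e : E, exists x y, [/\ A x, A y, y <> 0 & e = j x / j y];
  frac_base : forall e : E, e \in 1%VS <->
    exists x y, [/\ B x, B y, y <> 0 & e = j x / j y]
}.

Definition abelian_ext (R : unitRingType) (A B : set R) : Prop :=
  exists (k : fieldType) (E : splittingFieldType k) (j : R -> E),
    [/\ is_frac_ext A B j, galois 1%AS {:E}%AS
      & abelian 'Gal({:E}%AS / 1%AS)].

(* m is the exponent of Gal(A/B) = Gal(Frac(A)/Frac(B)) *)
Definition gal_exponent (R : unitRingType) (A B : set R) (m : nat) : Prop :=
  exists (k : fieldType) (E : splittingFieldType k) (j : R -> E),
    [/\ is_frac_ext A B j, galois 1%AS {:E}%AS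
      & exponent 'Gal({:E}%AS / 1%AS) = m].

Definition kummer (Gam : zmodType) (R : gradedRing Gam) (A B : set R) : Prop :=
  [/\ finite_over A B, abelian_ext A B
    & exists m, gal_exponent A B m /\
        exists2 z, deg0 B z & m.-primitive_root z].

Definition KUM (R : unitRingType) (A B : set R) : set R :=
  [set x | units A x /\ exists2 m, gal_exponent A B m & B (x ^+ m)].

(* Elements of kum(A/B) are the cosets x B^*, with x in KUM(A/B); they are
   multiplied as subsets of R. *)
Definition mulset (R : unitRingType) (X Y : set R) : set R :=
  [set x * y | x in X & y in Y].

Definition coset_units (R : unitRingType) (B : set R) (x : R) : set R :=
  [set x * y | y in units B].

Definition kum (R : unitRingType) (A B : set R) : set (set R) :=
  [set coset_units B x | x in KUM A B].

(* phi (a F_0^* ) = a F^* *)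
Definition phi (Gam : zmodType) (D : gcdAlg Gam) (X : set D) : set D :=
  mulset X (units (gbase D)).

(* psi (X) = g, for X in kum(K/F) and g in Gam_K / Gam_F *)
Definition psi_rel (Gam : zmodType) (D : gcdAlg Gam) (K : set D) (X : set D)
    (g : gquot D) : Prop :=
  exists a c, [/\ KUM K (gbase D) a, X = coset_units (gbase D) a,
    hasgr a c & gcl D c = g].

(* S is a subgroup of G and M an abelian group with product [mul]; the action
   is trivial. *)
Definition cocycle2 (G : zmodType) (S : set G) (T : Type) (mul : T -> T -> T)
    (M : set T) (c : G -> G -> T) : Prop :=
  (forall s t, S s -> S t -> M (c s t)) /\
  (forall s t u, S s -> S t -> S u ->
     mul (c s t) (c (s + t) u) = mul (c t u) (c s (t + u))).

Definition symmetric2 (G : zmodType) (S : set G) (T : Type) (c : G -> G -> T)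
  : Prop := forall s t, S s -> S t -> c s t = c t s.

(* c' and c differ by the coboundary of b *)
Definition cohomologous2 (G : zmodType) (S : set G) (T : Type)
    (mul : T -> T -> T) (M : set T) (c c' : G -> G -> T) : Prop :=
  exists2 b : G -> T, forall s, S s -> M (b s) &
    forall s t, S s -> S t ->
      mul (c' s t) (b (s + t)) = mul (mul (b s) (b t)) (c s t).

(* alpha is the 2-cocycle of the extension
     1 -> kum(K_0/F_0) -> kum(K/F) -> Gam_K / Gam_F -> 0
   attached to some set-theoretic section sec of psi *)
Definition represents_kum (Gam : zmodType) (D : gcdAlg Gam) (K : set D)
    (alpha : gquot D -> gquot D -> set D) : Prop :=
  exists2 sec : gquot D -> set D,
    forall g, suppq K g -> psi_rel K (sec g) g &
    forall g g', suppq K g -> suppq K g' ->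
      mulset (phi (alpha g g')) (sec (g + g')) = mulset (sec g) (sec g').

(* Main.v *)
Require Import Defs.
From HB Require Import structures.
From mathcomp Require Import all_boot all_order all_algebra.
From mathcomp Require Import all_fingroup all_solvable all_field.
From mathcomp Require Import ring_quotient boolp classical_sets functions.
Set Implicit Arguments.
Unset Strict Implicit.
Unset Printing Implicit Defensive.
Import GRing.Theory.
Local Open Scope classical_set_scope.
Local Open Scope ring_scope.

(** Every homogeneous lift of a subgroup S of Gam_D / Gam_F yields a factor set
of S in D_0: if y_s is a unit of D whose degree represents s, then
conjugation by y_s acts on D_0, and y_s y_t y_(s+t)^-1 divided by a central
element of the right degree is a unit of D_0.  The factor set (omega, d) is
the one attached to the lift z, with central correction h.

The point is that K gives another lift of Gam_K / Gam_F.  A section of psi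
picks classes y_s F^* in kum(K/F), and since an element of F^* may be absorbed
in y_s, each y_s can be chosen in K with exactly the degree of z_s.  Then:
- the quotients y_s z_s^-1 lie in D_0^*, and they exhibit the factor set of y,
  formed with the same correction h, as cohomologous to that of z
  ([lift_cohomologous]);
- K is commutative, so conjugation by y_s is the identity on K_0 and the
  cocycle d' of y is symmetric; since its values lie in K_0, the
  noncommutative cocycle identity becomes the one for the trivial action;
- because y is built from a section of psi, y_s y_t and y_(s+t) differ by an
  element of alpha_K(s, t) up to F^*.  Comparing degrees, the factor in F^*,
  corrected by h, lies in F_0^*, so d'(s, t) lies in KUM(K_0/F_0) and its
  coset is alpha_K(s, t).

What remains is that h is a 2-cocycle with the right degrees
([hfun_degree_cocycle]): its exponents are the carries in the addition of the
multi-indices, and carries satisfy the cocycle identity ([carry_cocycle]). *)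

(** * Homogeneous units *)

Section HomogeneousUnits.
Variables (Gam : zmodType) (D : gcdAlg Gam).
Implicit Types (x y : D) (g : Gam).

Lemma hasgr_unit x g : hasgr x g -> x \is a GRing.unit.
Proof. by move=> hx; have [] := galg_division (I : [set: D] x) hx. Qed.

Lemma hasgr1 : hasgr (1 : D) 0.
Proof.
by split; [apply/eqP; exact: oner_neq0 | exact: grading1 (hcompP D)].
Qed.

Lemma hasgr_mul x y g h : hasgr x g -> hasgr y h -> hasgr (x * y) (g + h).
Proof. by move=> hx hy; apply: hasgrM => //; apply: hasgr_unit hx. Qed.

Lemma hasgr_div x y g h : hasgr x g -> hasgr y h -> hasgr (x / y) (g - h).
Proof. by move=> hx hy; apply: hasgr_mul => //; apply: hasgrV. Qed.

Lemma hasgrX x g n : hasgr x g -> hasgr (x ^+ n) (g *+ n).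
Proof.
move=> hx; elim: n => [|n IHn]; first by rewrite expr0 mulr0n; apply: hasgr1.
by rewrite exprS mulrS; apply: hasgr_mul.
Qed.

Lemma hasgr_prod (I : finType) (x : I -> D) (g : I -> Gam) :
  (forall i, hasgr (x i) (g i)) -> hasgr (\prod_i x i) (\sum_i g i).
Proof.
move=> hx; apply: (big_ind2 (@hasgr Gam D)) => // [|a b c d ha hc].
  exact: hasgr1.
exact: hasgr_mul.
Qed.

Lemma deg0_units (A : set D) x :
  graded_division A -> A x -> hasgr x 0 -> units (deg0 A) x.
Proof.
move=> dA Ax hx; have [_ ux Ax'] := dA _ _ Ax hx; have [_ hV] := hasgrV hx.
by split=> //; split=> //; [case: hx | rewrite oppr0 in hV].
Qed.

Lemma gbase_comm (f x : D) : gbase D f -> f * x = x * f.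
Proof. by rewrite -gbase_center => -[_]; apply. Qed.

Lemma gclD g h : gcl D (g + h) = gcl D g + gcl D h.
Proof. exact: (raddfD (\pi_(Quotient.quot (GamF D)))%qT). Qed.

Lemma gclMn g n : gcl D (g *+ n) = gcl D g *+ n.
Proof. exact: (raddfMn (\pi_(Quotient.quot (GamF D)))%qT). Qed.

Lemma gcl_sum (I : finType) (g : I -> Gam) :
  gcl D (\sum_i g i) = \sum_i gcl D (g i).
Proof. exact: (raddf_sum (\pi_(Quotient.quot (GamF D)))%qT). Qed.

Lemma suppqD (A : set D) s t :
  graded_subring A -> suppq A s -> suppq A t -> suppq A (s + t).
Proof.
move=> [_ _ AM _] [g [x Ax hx] <-] [h [y Ay hy] <-].
exists (g + h); last exact: gclD.
by exists (x * y); [apply: AM | apply: hasgr_mul].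
Qed.

(** * Conjugation by homogeneous lifts *)

Definition conjby (y : gquot D -> D) (s : gquot D) (a : D) : D :=
  y s * a * (y s)^-1.

(** The factor h s t stands for a central unit bringing the degree back
to 0. *)
Definition lift_cocycle (h : gquot D -> gquot D -> D) (y : gquot D -> D)
    (s t : gquot D) : D :=
  y s * y t * (y (s + t))^-1 * (h s t)^-1.

Definition homog_lift (S : set (gquot D)) (e : gquot D -> Gam)
    (y : gquot D -> D) : Prop :=
  forall s, S s -> hasgr (y s) (e s).

(** What a correction factor h must satisfy for [lift_cocycle h y] to be a
factor set in D_0 whenever y lifts S with degrees e. *)
Record degree_cocycle (S : set (gquot D)) (e : gquot D -> Gam)
    (h : gquot D -> gquot D -> D) : Prop := DegreeCocycle {
  dcocD : forall s t, S s -> S t -> S (s + t);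
  dcoc_cl : forall s, S s -> gcl D (e s) = s;
  dcoc_base : forall s t, S s -> S t -> gbase D (h s t);
  dcoc_gr : forall s t, S s -> S t -> hasgr (h s t) (e s + e t - e (s + t));
  dcoc_sym : forall s t, S s -> S t -> h s t = h t s;
  dcocP : forall s t u, S s -> S t -> S u ->
    h s t * h (s + t) u = h t u * h s (t + u)
}.

Lemma degree_cocycle_sub (S S' : set (gquot D)) e h :
  S' `<=` S -> (forall s t, S' s -> S' t -> S' (s + t)) ->
  degree_cocycle S e h -> degree_cocycle S' e h.
Proof.
move=> sS' S'D [SD Scl Sb Sgr Ssym SP].
split=> // [s /sS'|s t /sS' Ss /sS'|s t /sS' Ss /sS'|s t /sS' Ss /sS'|].
- exact: Scl.
- exact: Sb.
- exact: Sgr.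
- exact: Ssym.
- by move=> s t u /sS' Ss /sS' St /sS'; apply: SP.
Qed.

Lemma deg0_conj x a g : hasgr x g -> deg0 [set: D] a ->
  deg0 [set: D] (x * a * x^-1).
Proof.
move=> hx [_ ha]; split=> //; have [_ hx'] := hasgrV hx; case: hx => _ hx.
have := gradingM (hcompP D) (gradingM (hcompP D) hx ha) hx'.
by rewrite addr0 subrr.
Qed.

Lemma conj_ring_aut x g : hasgr x g ->
  ring_aut (deg0 [set: D]) (fun a => x * a * x^-1).
Proof.
move=> hx; have ux := hasgr_unit hx; split.
- split=> [a|a c _ _|a ha].
  + exact: deg0_conj hx.
  + by move/mulIr; rewrite unitrV => /(_ ux)/(mulrI ux).
  + exists (x^-1 * a * x); last by rewrite !mulrA mulrV // mul1r mulrK.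
    by have := deg0_conj (hasgrV hx) ha; rewrite invrK.
- by rewrite mulr1 mulrV.
- by move=> a c _ _; rewrite mulrDr mulrDl.
- by move=> a c _ _; rewrite !mulrA divrK.
Qed.

Section Lifts.
Variables (S : set (gquot D)) (e : gquot D -> Gam)
  (h : gquot D -> gquot D -> D).
Hypothesis hP : degree_cocycle S e h.

Lemma dcoc_unit s t : S s -> S t -> h s t \is a GRing.unit.
Proof. by move=> Ss St; apply: hasgr_unit (dcoc_gr hP Ss St). Qed.

Lemma dcocV_comm s t x : S s -> S t -> (h s t)^-1 * x = x * (h s t)^-1.
Proof.
move=> Ss St; apply/esym/(@commrV D x)/esym.
by apply/gbase_comm/(dcoc_base hP).
Qed.

Lemma lift_cocycle_gr (y : gquot D -> D) s t : homog_lift S e y -> S s -> S t ->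
  hasgr (lift_cocycle h y s t) 0.
Proof.
move=> hy Ss St; have Sst := dcocD hP Ss St.
rewrite -(subrr (e s + e t - e (s + t))).
apply: hasgr_div (dcoc_gr hP Ss St).
by apply: hasgr_div (hy _ Sst); apply: hasgr_mul; apply: hy.
Qed.

Lemma mul_lift (y : gquot D -> D) s t : homog_lift S e y -> S s -> S t ->
  y s * y t = lift_cocycle h y s t * y (s + t) * h s t.
Proof.
move=> hy Ss St; have ust := hasgr_unit (hy _ (dcocD hP Ss St)).
rewrite /lift_cocycle -[_ * _^-1 * y (s + t)]mulrA dcocV_comm //.
by rewrite mulrA !divrK // dcoc_unit.
Qed.

(** The two identities of a factor set are associativity in D, read through
[mul_lift]: composing conjugations conjugates by y_s y_t, where the central h
has no effect, and the cocycle identity compares the two bracketings of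
y_s y_t y_u, whose central factors agree by [dcocP]. *)
Lemma lift_factor_set (y : gquot D -> D) : homog_lift S e y ->
  factor_set S (deg0 [set: D]) (@theta Gam D) (conjby y) (lift_cocycle h y).
Proof.
move=> hy; have uy s : S s -> y s \is a GRing.unit.
  by move=> Ss; apply: hasgr_unit (hy s Ss).
have SD := dcocD hP; have yM s t Ss St := @mul_lift y s t hy Ss St.
have ud s t Ss St := hasgr_unit (@lift_cocycle_gr y s t hy Ss St).
have hC s t x : S s -> S t -> h s t * x = x * h s t.
  by move=> Ss St; apply/gbase_comm/(dcoc_base hP).
split.
- by move=> s Ss; apply: conj_ring_aut (hy s Ss).
- move=> s t Ss St; apply: deg0_units => //; last exact: lift_cocycle_gr.
  exact: galg_division.
- by move=> s a Ss ca; rewrite -[in RHS](dcoc_cl hP Ss) (thetaE (hy s Ss) ca).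
- move=> s t a Ss St _; have Sst := SD _ _ Ss St.
  have uh := dcoc_unit Ss St; have uds := ud _ _ Ss St.
  transitivity (y s * y t * a * (y s * y t)^-1).
    by rewrite invrM ?uy // /conjby !mulrA.
  rewrite yM // -(mulrA _ (h s t)) hC // invrM //; last first.
    by rewrite unitrMl ?uy.
  by rewrite /conjby invrM ?uy // !mulrA mulrK.
- move=> s t u Ss St Su; have Sst := SD _ _ Ss St; have Stu := SD _ _ St Su.
  have Sstu := SD _ _ Sst Su.
  have uh : y (s + t + u) * (h s t * h (s + t) u) \is a GRing.unit.
    by rewrite unitrMr ?uy // unitrMr ?dcoc_unit.
  move: {ud} (lift_cocycle h y) yM => d yM.
  (* both sides, multiplied by y_(s+t+u) and the factors h, are y_s y_t y_u *)
  apply: (mulIr uh); transitivity (y s * y t * y u).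
    rewrite (yM s t) // -[RHS]mulrA (hC s t (y u)) // [RHS]mulrA.
    by rewrite -[in RHS](mulrA (d s t)) yM // -!mulrA (hC s t (h _ _)).
  rewrite (dcocP hP) // -(mulrA (y s)) (yM t u) //.
  (* moving d t u in front of y_s conjugates it by y_s *)
  have -> : y s * (d t u * y (t + u) * h t u)
      = conjby y s (d t u) * (y s * y (t + u)) * h t u.
    by rewrite /conjby !mulrA divrK ?uy.
  by rewrite (yM s) // addrA -!mulrA (hC t u).
Qed.

(** Two lifts with the same degrees differ by units of D_0; the common
correction h drops out of the comparison. *)
Lemma lift_cohomologous (y z : gquot D -> D) :
  homog_lift S e y -> homog_lift S e z ->
  fset_cohomologous S (deg0 [set: D]) (conjby z) (lift_cocycle h z)
    (conjby y) (lift_cocycle h y).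
Proof.
move=> hy hz; exists (fun s => y s / z s); split.
- move=> s Ss; apply: deg0_units => //; first exact: galg_division.
  by rewrite -(subrr (e s)); apply: hasgr_div; [apply: hy | apply: hz].
- move=> s x Ss _; have us := hasgr_unit (hz s Ss).
  have us' := hasgr_unit (hy s Ss).
  by rewrite /conjby invrM ?unitrV // invrK !mulrA !divrK.
- move=> s t Ss St; have Sst := dcocD hP Ss St.
  have [us ut ust] := And3 (hasgr_unit (hz s Ss)) (hasgr_unit (hz t St))
    (hasgr_unit (hz _ Sst)).
  rewrite /lift_cocycle /conjby invrM ?unitrV ?(hasgr_unit (hy _ Sst)) // invrK.
  rewrite !mulrA !divrK // -[_ * z (s + t)]mulrA dcocV_comm // !mulrA divrK //.
  by rewrite -[RHS]mulrA dcocV_comm // mulrA.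
Qed.

End Lifts.
End HomogeneousUnits.

(** * The factor set of a frame *)

Section FrameFactorSet.
Variables (Gam : zmodType) (D : gcdAlg Gam) (b : frame D).
Local Notation GD := (suppq [set: D]).
Local Notation clz i := (gcl D (fdelta b i)).

Lemma ord_modn i n : clz i *+ (n %% ford b i) = clz i *+ n.
Proof.
have [_ q0 _] := fordP (f := b) i.
by rewrite {2}(divn_eq n (ford b i)) mulrnDr mulnC mulrnA q0 mul0rn add0r.
Qed.

(** The integer coordinates given by a basis are reduced modulo the orders. *)
Lemma mindex_exists g : GD g -> exists m : {ffun 'I_(frank b) -> nat},
  (forall i, (m i < ford b i)%N) /\ g = \sum_i clz i *+ m i.
Proof.
have [_ gen _] := fbasis b; move=> /gen[m ->].
exists [ffun i => absz (m i %% (ford b i)%:Z)%Z].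
have q i : (0 < ford b i)%N by case: (fordP i).
have mE i : (m i %% (ford b i)%:Z)%Z = absz (m i %% (ford b i)%:Z)%Z :> int.
  by rewrite gez0_abs // modz_ge0 // eqz_nat -lt0n.
split=> [i|]; first by rewrite ffunE -ltz_nat -mE ltz_pmod ?ltz_nat.
apply: eq_bigr => i _; rewrite ffunE pmulrn -mE {1}(divz_eq (m i) (ford b i)).
rewrite mulrzDr mulrC mulrzA -pmulrn; have [_ -> _] := fordP i.
by rewrite mul0rz add0r.
Qed.

Lemma mindexP g : GD g ->
  (forall i, (mindex b g i < ford b i)%N) /\ g = \sum_i clz i *+ mindex b g i.
Proof. by move/mindex_exists => ex; apply: (xgetPex _ ex). Qed.

Lemma multiindex_inj (m n : 'I_(frank b) -> nat) :
  (forall i, (m i < ford b i)%N) -> (forall i, (n i < ford b i)%N) ->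
  \sum_i clz i *+ m i = \sum_i clz i *+ n i -> m =1 n.
Proof.
move=> mq nq Emn i; have [_ _ indep] := fbasis b.
have [_ _ min] := fordP i.
have E : clz i *+ m i = clz i *+ n i.
  apply/eqP; rewrite -subr_eq0; apply/eqP.
  have := indep (fun j => (m j)%:Z - (n j)%:Z).
  move/(_ _ i); rewrite mulrzBr -!pmulrn; apply.
  rewrite (eq_bigr (fun j => clz j *+ m j - clz j *+ n j)) => [|j _].
    by rewrite sumrB Emn subrr.
  by rewrite mulrzBr -!pmulrn.
have half (k l : nat) : (k < l < ford b i)%N -> clz i *+ k <> clz i *+ l.
  case/andP=> kl lq Ekl; apply: (min (l - k)%N).
    by rewrite subn_gt0 kl (leq_ltn_trans (leq_subr _ _)).
  by rewrite mulrnBr ?(ltnW kl) // Ekl subrr.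
case: (ltngtP (m i) (n i)) => // lt.
  by case: (half _ _ _ E); rewrite lt nq.
by case: (half _ _ _ (esym E)); rewrite lt mq.
Qed.

Lemma mindexD g g' i : GD g -> GD g' ->
  mindex b (g + g') i = ((mindex b g i + mindex b g' i) %% ford b i)%N.
Proof.
move=> Gg Gg'; have Ggg' : GD (g + g').
  by apply: suppqD => //; split.
have [mq mE] := mindexP Ggg'.
have [_ E] := mindexP Gg; have [_ E'] := mindexP Gg'.
apply: (multiindex_inj (n := fun j =>
  ((mindex b g j + mindex b g' j) %% ford b j)%N)) => // [j|].
  by rewrite ltn_mod; case: (fordP j).
rewrite -mE {1}E {1}E' -big_split /=; apply: eq_bigr => j _.
by rewrite ord_modn mulrnDr.
Qed.

(** The degree of z^m, for m the multi-index of g. *)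
Definition frame_degree (g : gquot D) : Gam :=
  \sum_i fdelta b i *+ mindex b g i.

Lemma zbar_lift : homog_lift GD frame_degree (zbar b).
Proof.
by move=> g _; apply: hasgr_prod => i; apply: hasgrX; apply: fz_gr.
Qed.

Lemma gbase_prod (I : finType) (x : I -> D) :
  (forall i, gbase D (x i)) -> gbase D (\prod_i x i).
Proof.
move=> Fx; have [[F1 _ FM _] _ _] := gbase_field D.
by apply: (big_ind (gbase D)) => //; apply: FM.
Qed.

Lemma gbaseX (x : D) n : gbase D x -> gbase D (x ^+ n).
Proof.
have [[F1 _ FM _] _ _] := gbase_field D.
by move=> Fx; elim: n => [|n IHn]; rewrite ?expr0 ?exprS //; apply: FM.
Qed.

(** The product of an arbitrary family in D depends on the order, but central
factors can be pulled out. *)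
Lemma gbase_prodM (I : finType) (x y : I -> D) : (forall i, gbase D (y i)) ->
  \prod_i (x i * y i) = (\prod_i x i) * \prod_i y i.
Proof.
move=> Fy; elim: (index_enum I) => [|i r IHr]; first by rewrite !big_nil mulr1.
rewrite !big_cons IHr -!mulrA; congr (_ * _).
by rewrite !mulrA; congr (_ * _); rewrite gbase_comm.
Qed.

Lemma gbase_hfun g g' : gbase D (hfun b g g').
Proof. by apply: gbase_prod => i; apply: gbaseX; have [] := fxP i. Qed.

(** Both sides are (m + n + p) %/ q. *)
Lemma carry_cocycle q m n p : (0 < q)%N ->
  ((m + n) %/ q + ((m + n) %% q + p) %/ q =
   (n + p) %/ q + (m + (n + p) %% q) %/ q)%N.
Proof.
move=> q0; rewrite -!divnMDl // !addnA -divn_eq.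
by rewrite [(_ + m)%N]addnC -!addnA -divn_eq addnA.
Qed.

Lemma hfun_cocycle g g' g'' : GD g -> GD g' -> GD g'' ->
  hfun b g g' * hfun b (g + g') g'' = hfun b g' g'' * hfun b g (g' + g'').
Proof.
move=> Gg Gg' Gg''; have Fx i : gbase D (fx b i) by have [] := fxP i.
rewrite -!gbase_prodM; do ?by move=> i; apply: gbaseX.
apply: eq_bigr => i _; rewrite -!exprD !mindexD //.
by rewrite carry_cocycle //; case: (fordP i).
Qed.

Lemma hfun_gr g g' : GD g -> GD g' ->
  hasgr (hfun b g g')
    (frame_degree g + frame_degree g' - frame_degree (g + g')).
Proof.
move=> Gg Gg'.
have -> : frame_degree g + frame_degree g' - frame_degree (g + g') =
    \sum_i fdelta b i *+ ford b i
      *+ ((mindex b g i + mindex b g' i) %/ ford b i).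
  rewrite -big_split -sumrB; apply: eq_bigr => i _ /=; rewrite mindexD //.
  rewrite -mulrnDr {1}(divn_eq (mindex b g i + mindex b g' i) (ford b i)).
  by rewrite mulrnDr addrK mulnC mulrnA.
by apply: hasgr_prod => i; apply: hasgrX; apply: fx_gr.
Qed.

Lemma hfun_degree_cocycle : degree_cocycle GD frame_degree (hfun b).
Proof.
split=> [s t|s Gs|s t _ _|s t|s t _ _|s t u].
- by apply: suppqD; split.
- rewrite gcl_sum; have [_ {2}->] := mindexP Gs.
  by apply: eq_bigr => i _; rewrite gclMn.
- exact: gbase_hfun.
- exact: hfun_gr.
- by apply: eq_bigr => i _; rewrite addnC.
- exact: hfun_cocycle.
Qed.

End FrameFactorSet.

(** * Cosets and Kummer groups *)

Section Cosets.
Variables (R : unitRingType).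
Implicit Types (A B : set R) (x v : R).

Definition mul_closed A : Prop :=
  A 1 /\ forall x y, A x -> A y -> A (x * y).

Lemma units1 A : mul_closed A -> units A 1.
Proof. by case=> A1 _; split; rewrite ?invr1 ?unitr1. Qed.

Lemma unitsM A x v : mul_closed A -> units A x -> units A v -> units A (x * v).
Proof.
move=> [_ AM] [Ax ux Ax'] [Av uv Av']; split; first exact: AM.
  by rewrite unitrMl.
by rewrite invrM //; apply: AM.
Qed.

Lemma unitsV A x : units A x -> units A x^-1.
Proof. by case=> Ax ux Ax'; split; rewrite ?invrK ?unitrV. Qed.

Lemma coset_unitsM B x v : mul_closed B -> units B v ->
  coset_units B (x * v) = coset_units B x.
Proof.
move=> cB Uv; apply/seteqP; split=> _ [u Uu <-].
  by exists (v * u); [apply: unitsM | rewrite mulrA].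
exists (v^-1 * u); first by apply: unitsM => //; apply: unitsV.
by rewrite mulrA mulrK //; case: Uv.
Qed.

Lemma KUM_mul A B x v : mul_closed A -> mul_closed B -> B `<=` A ->
  x * v = v * x -> units B v -> KUM A B x -> KUM A B (x * v).
Proof.
move=> cA cB sBA xv Uv [Ux [m expm Bxm]]; split.
  by apply: unitsM => //; case: Uv => Bv uv Bv'; split=> //; apply: sBA.
exists m => //; rewrite exprMn_comm //; apply: (cB.2) => //.
elim: m {expm Bxm} => [|m IHm]; first by rewrite expr0; case: cB.
by rewrite exprS; apply: (cB.2) => //; case: Uv.
Qed.

(** Membership in KUM includes the existence of a Galois exponent, which any
other member supplies. *)
Lemma KUM1 A B x : mul_closed A -> mul_closed B -> KUM A B x -> KUM A B 1.
Proof.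
move=> cA [B1 _] [_ [m expm _]]; split; first exact: units1.
by exists m; rewrite ?expr1n.
Qed.

Lemma mulset_units B x : mul_closed B ->
  mulset (coset_units B x) (units B) = coset_units B x.
Proof.
move=> cB; apply/seteqP; split=> [_ [_ [u Uu <-]] [v Uv <-]|_ [u Uu <-]].
  by exists (u * v); [apply: unitsM | rewrite mulrA].
exists (x * u); first by exists u.
by exists 1; [apply: units1 | rewrite mulr1].
Qed.

Lemma coset_units1 B : coset_units B 1 = units B.
Proof.
apply/seteqP; split=> [_ [u Uu <-]|u Uu]; first by rewrite mul1r.
by exists u; rewrite ?mul1r.
Qed.

Lemma mulset_unitsl B x : mul_closed B -> (forall v, B v -> v * x = x * v) ->
  mulset (units B) (coset_units B x) = coset_units B x.
Proof.
move=> cB Bx; rewrite -[RHS]mulset_units //; apply/seteqP; split.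
  move=> _ [u Uu [_ [v Uv <-]] <-]; exists (x * u); first by exists u.
  by exists v => //; rewrite mulrA -Bx //; case: Uu.
move=> _ [_ [u Uu <-] [v Uv <-]]; exists u => //; exists (x * v).
  by exists v.
by rewrite mulrA Bx //; case: Uu.
Qed.

End Cosets.

Lemma graded_mul_closed (Gam : zmodType) (R : gradedRing Gam) (A : set R) :
  graded_subring A -> mul_closed A.
Proof. by case. Qed.

Lemma deg0_mul_closed (Gam : zmodType) (R : gradedRing Gam) (A : set R) :
  graded_subring A -> mul_closed (deg0 A).
Proof.
case=> A1 _ AM _; split; first by split=> //; apply: grading1 (hcompP R).
move=> x y [Ax hx] [Ay hy]; split; first exact: AM.
by rewrite -[0]addr0; apply: (gradingM (hcompP R)).
Qed.

Theorem theorem2p4 (Gam : zmodType) (hGam : torsion_free Gam)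
    (D : gcdAlg Gam) (b : frame D)
    (K : set D) (hK : graded_subfield K) (hKum : kummer K (gbase D))
    (alpha : gquot D -> gquot D -> set D)
    (halpha : cocycle2 (suppq K) (@mulset D)
                (kum (deg0 K) (deg0 (gbase D))) alpha)
    (halpha_sym : symmetric2 (suppq K) alpha)
    (halpha_rep : represents_kum K alpha) :
  exists (d' : gquot D -> gquot D -> D) (omega' : gquot D -> D -> D),
    [/\ cocycle2 (suppq K) *%R (KUM (deg0 K) (deg0 (gbase D))) d',
        symmetric2 (suppq K) d',
        forall g a, suppq K g -> deg0 K a -> omega' g a = a,
        factor_set (suppq K) (deg0 [set: D]) (@theta Gam D) omega' d' /\
        fset_cohomologous (suppq K) (deg0 [set: D])
          (omega b) (dfun b) omega' d'
      & cohomologous2 (suppq K) (@mulset D) (kum (deg0 K) (deg0 (gbase D)))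
          (fun g g' => coset_units (deg0 (gbase D)) (d' g g')) alpha].
Proof.
have [[Ksub KC _] sFK] := hK.
have [Fsub _ Fdiv] := gbase_field D.
have [cK cF] := (graded_mul_closed Ksub, graded_mul_closed Fsub).
have [cK0 cF0] := (deg0_mul_closed Ksub, deg0_mul_closed Fsub).
have [sec secP secM] := halpha_rep.
have sKD : suppq K `<=` suppq [set: D].
  by move=> _ [g [x _ hx] <-]; exists g => //; exists x.
pose e := frame_degree b; pose S := suppq K.
have SD s t : S s -> S t -> S (s + t) by apply: suppqD.
have hP : degree_cocycle S e (hfun b).
  exact: degree_cocycle_sub sKD SD (hfun_degree_cocycle b).
(* dividing a representative of sec s by an element of F^* aligns its degree
   with that of zbar b s *)
have /choice[y yP] : forall s, exists y : D, S s ->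
    [/\ K y, hasgr y (e s) & sec s = coset_units (gbase D) y].
  move=> s; have [Ss|nSs] := pselect (S s); last by exists 0 => /nSs.
  have [a [c [[[Ka _ _] _] secE hac cs]]] := secP s Ss.
  have [f Ff hf] : supp (gbase D) (c - e s).
    by apply/gclE; rewrite cs (dcoc_cl hP).
  have Uf := Fdiv _ _ Ff hf; exists (a * f^-1) => _; split.
  - by apply: (cK.2) => //; apply: sFK; case: Uf.
  - by have := hasgr_div hac hf; rewrite opprB addrCA subrr addr0.
  - by rewrite coset_unitsM //; apply: unitsV.
have Ky s : S s -> K (y s) by case/yP.
have hy : homog_lift S e y by move=> s /yP[].
have hz : homog_lift S e (zbar b) by move=> s /sKD; apply: zbar_lift.
pose d := lift_cocycle (hfun b) y.
have dfact := lift_factor_set hP hy.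
(* y s * y t lies in (alpha s t) F^* y_(s+t): the factor v is the part in F^*,
   and comparing degrees puts it in F_0^* *)
have dE s t : S s -> S t -> exists u v, [/\ KUM (deg0 K) (deg0 (gbase D)) u,
    alpha s t = coset_units (deg0 (gbase D)) u, units (deg0 (gbase D)) v
    & d s t = u * v].
  move=> Ss St; have [u Ku uE] := (halpha.1 s t Ss St).
  have Sst := SD _ _ Ss St; have [_ hyst _] := yP _ Sst.
  have cosy r : S r -> sec r (y r).
    move=> Sr; have [_ _ ->] := yP r Sr.
    by exists 1; [apply: units1 | rewrite mulr1].
  have : mulset (sec s) (sec t) (y s * y t).
    by exists (y s); [apply: cosy | exists (y t) => //; apply: cosy].
  rewrite -secM // -uE => -[_ [_ [u1 [[Fu1 _] uu1 _] <-] [f Uf <-]]].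
  have [_ _ ->] := yP _ Sst; move=> [_ [f' Uf' <-]] yE.
  have [u0 hu] : hasgr u 0.
    have [[[_ hu] uu _] _] := Ku; split=> //.
    by move=> u0; move: uu; rewrite u0 unitr0.
  have uu : u \is a GRing.unit by have [[]] := Ku.
  have [Uf0 Uf0'] : gbase D f /\ gbase D f' by case: Uf => ? _ _; case: Uf'.
  have dv : d s t = u * (u1 * f * f' / hfun b s t).
    rewrite /d /lift_cocycle -yE !mulrA -(mulrA _ f') (gbase_comm _ Uf0') mulrA.
    by rewrite mulrK // (hasgr_unit hyst).
  exists u, (u1 * f * f' / hfun b s t); split=> //.
  apply: deg0_units => //.
    apply: (cF.2); first by do 2?apply: (cF.2).
    by have [] := Fdiv _ _ (dcoc_base hP Ss St) (dcoc_gr hP Ss St).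
  have -> : u1 * f * f' / hfun b s t = u^-1 * d s t by rewrite dv mulKr.
  rewrite -[0]addr0 -{1}oppr0; apply: hasgr_mul; first exact: hasgrV.
  exact: (lift_cocycle_gr hP).
have dK s t : S s -> S t -> KUM (deg0 K) (deg0 (gbase D)) (d s t).
  move=> Ss St; have [u [v [Ku _ Uv ->]]] := dE s t Ss St.
  apply: KUM_mul => //; first by move=> x [Fx hx]; split=> //; apply: sFK.
  by rewrite [RHS]gbase_comm //; case: Uv => -[].
have dcos s t : S s -> S t ->
    coset_units (deg0 (gbase D)) (d s t) = alpha s t.
  move=> Ss St; have [u [v [_ -> Uv ->]]] := dE s t Ss St.
  by rewrite coset_unitsM.
have fixK s a : S s -> K a -> conjby y s a = a.
  move=> Ss Ka; rewrite /conjby (KC _ _ (Ky s Ss) Ka) mulrK //.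
  exact: hasgr_unit (hy s Ss).
exists d, (conjby y); split.
  (* conjugation by y s fixes d t r, an element of K_0 *)
- split=> // s t r Ss St Sr; rewrite (fset_cocycle dfact) // fixK //.
  by have [[[]]] := dK t r St Sr.
- move=> s t Ss St; rewrite /d /lift_cocycle (KC _ _ (Ky s Ss) (Ky t St)).
  by rewrite addrC (dcoc_sym hP Ss St).
- by move=> s a Ss [Ka _]; apply: fixK.
- by split=> //; apply: lift_cohomologous hP _ _ hy hz.
  (* the coset of d s t is alpha s t, so the trivial cochain F_0^* will do *)
- exists (fun=> units (deg0 (gbase D))) => [s Ss|s t Ss St].
    by exists 1; [apply: KUM1 (dK s s Ss Ss) | apply: coset_units1].
  rewrite -dcos // mulset_units //.
  rewrite -[X in mulset (mulset X _) _]coset_units1 mulset_units //.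
  by rewrite coset_units1 mulset_unitsl // => v [Fv _]; apply: gbase_comm.
Qed.
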